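(* Let $k=2$, let $(X_1,X_2)$ and the family $\{P_\theta:\theta=(\theta_1,\theta_2)\in\mathbf{R}^2\}$ satisfy the distributional and monotonicity assumptions in the context, let $\alpha\in(0,1)$ and $\varepsilon=(\varepsilon_1,\varepsilon_2)$ with $\varepsilon_1,\varepsilon_2>0$. Consider testing $H_1:\theta_1\le 0$ and $H_2:\theta_2\le 0$, and let $\mathcal{C}$ be the class of decision rules that are monotone and satisfy $\mathrm{FWER}\le\alpha$. Let $b_i$ satisfy $P_0\{X_i\ge b_i\}=\alpha$, $i=1,2$. (i) A rule $D\in\mathcal{C}$ maximizes, among rules in $\mathcal{C}$, $$\inf_{\theta\in A_2(\varepsilon)}P_\theta\{d_{1,1}\}$$ if $$d_{1,1}=\{X_1>b_1,\,X_2>b_2\}\qquad(\ast\ast)$$ and $d_i\subset\{X_i>b_i\}$ for $i=1,2$. Its minimum probability over $A_2(\varepsilon)$, i.e. its value of this criterion, is $P_{\varepsilon_1,\varepsilon_2}\{X_1>b_1,X_2>b_2\}$. (ii) The (stepup) rule $D\in\mathcal{C}$ satisfying $(\ast\ast)$ that maximizes, among rules in $\mathcal{C}$ satisfying $(\ast\ast)$, $$\inf_{\theta\in A_1(\varepsilon)}P_\theta\{d_{0,0}^c\}\qquad(\ast)$$ is given by $$d_{0,1}=\{X_1\le b_1,\,X_2>\tilde a_2\},\qquad d_{1,0}=\{X_1>\tilde a_1,\,X_2\le b_2\},\qquad d_{0,0}=\{X_1\le\tilde a_1,\,X_2\le\tilde a_2\}\cap d_{1,1}^c,$$ where $\tilde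 a_1,\tilde a_2$ are determined so that $$P_{0,0}\{d_{0,0}^c\}=\alpha\quad\text{and}\quad P_{\varepsilon_1}\{X_1\ge\tilde a_1\}=P_{\varepsilon_2}\{X_2\ge\tilde a_2\}.$$ The common value $P_{\varepsilon_1}\{X_1\ge\tilde a_1\}=P_{\varepsilon_2}\{X_2\ge\tilde a_2\}$ is the minimum probability of $D$ over $A_1(\varepsilon)$, i.e. its value of $(\ast)$. (iii) The result (ii) holds for $D$ if the criterion $(\ast)$ is replaced by $$\inf_{\theta\in A_1(\varepsilon)}P_\theta\{\text{reject at least one false hypothesis}\},$$ and the common value $P_{\varepsilon_1}\{X_1\ge\tilde a_1\}=P_{\varepsilon_2}\{X_2\ge\tilde a_2\}$ is also the maximum value of this criterion.
   Context: Standing assumptions. $X=(X_1,\dots,X_k)$ takes values in $\mathbf{R}^k$ and has distribution $P_\theta$ indexed by $\theta=(\theta_1,\dots,\theta_k)\in\mathbf{R}^k$. The null hypothesis $H_i$ is $\theta_i\le 0$, tested against $\theta_i>0$; $H_i$ is called true at $\theta$ if $\theta_i\le0$ and false otherwise. All sets and rules are assumed measurable. (a) The distribution of any subcollection $\{X_i:i\in I\}$ depends only on $\{\theta_i:i\in I\}$; $X_i\to-\infty$ in probability as $\theta_i\to-\infty$ and $X_i\to+\infty$ in probability as $\theta_i\to+\infty$. Subscripts on $P$ list only the relevant parameters, e.g. $P_{\varepsilon_1}\{X_1\ge a\}$ refers to the marginal of $X_1$ with $\theta_1=\varepsilon_1$, and $P_0\{X_i\ge b\}$ to that of $X_i$ with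 $\theta_i=0$. (b) For each $\theta$, $X$ has a joint density with respect to Lebesgue measure that is positive on $\mathbf{R}^k$. (c) Monotonicity. A set $\mathcal{M}\subset\mathbf{R}^k$ is monotone increasing if $x\in\mathcal{M}$ and $x_i\le y_i$ for all $i$ imply $y\in\mathcal{M}$. For every $\delta\in\{-1,1\}^k$, every monotone increasing $\mathcal{M}$, and all $\theta,\gamma$ with $\delta_i\theta_i\le\delta_i\gamma_i$ for all $i$, $P_\theta\{(\delta_1X_1,\dots,\delta_kX_k)\in\mathcal{M}\}\le P_\gamma\{(\delta_1X_1,\dots,\delta_kX_k)\in\mathcal{M}\}$. Decision rules. A decision rule assigns to each $x\in\mathbf{R}^k$ a set $I_x\subset\{1,\dots,k\}$ of indices $i$ for which $H_i$ is rejected. It is monotone if $x_i\le y_i$ for all $i\in I_x$ and $y_i<x_i$ for all $i\notin I_x$ imply $I_y=I_x$. $\mathrm{FWER}\le\alpha$ (strong control of the familywise error rate) means that for every $\theta$, $P_\theta\{\text{some true } H_i\text{ is rejected}\}\le\alpha$. For $k=2$, a rule $D$ partitions the sample space into $d_{0,0}$ (reject neither), $d_{0,1}$ (reject only $H_2$), $d_{1,0}$ (reject only $H_1$), $d_{1,1}$ (reject both); $d_1=d_{1,0}\cup d_{1,1}$ and $d_2=d_{0,1}\cup d_{1,1}$ are the regions where $H_1$, respectively $H_2$, is rejected. $A_1(\varepsilon)=\{\theta:\theta_1>\varepsilon_1\}\cup\{\theta:\theta_2>\varepsilon_2\}$ and $A_2(\varepsilon)=\{\theta:\theta_1>\vare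psilon_1\}\cap\{\theta:\theta_2>\varepsilon_2\}$.
   Formalization: The value in (i) and the optimality and values in (ii), (iii) are proved assuming, for each i and c, that P_t{X_i ≥ c} is right-continuous in t at t = ε_i; without it they can fail, as A_1(ε), A_2(ε) are open. In (ii), (iii) the maximizer is unique up to null sets. *)

(* Defs.v *)
From HB Require Import structures.
From mathcomp Require Import all_boot all_order all_algebra.
From mathcomp Require Import all_classical all_reals all_analysis.

Set Implicit Arguments.
Unset Strict Implicit.
Unset Printing Implicit Defensive.

Import Order.TTheory GRing.Theory Num.Theory.
Import numFieldNormedType.Exports.

Local Open Scope classical_set_scope.
Local Open Scope ring_scope.

(* The indices 1, 2 of the two hypotheses are the elements i1, i2 of 'I_2. *)
Definition i1 : 'I_2 := ord0.
Definition i2 : 'I_2 := ord_max.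

Definition coordinate (R : Type) (x : R * R) (i : 'I_2) : R :=
  if i == i1 then x.1 else x.2.

Notation plane R := (measurableTypeR R * measurableTypeR R)%type.

Section Model.
Context {R : realType}.

(* P theta is the distribution on R^2 of X = (X_1, X_2); an event {X \in B} is
   written as the set B itself. *)
Definition dist_family : Type := R * R -> probability (plane R) R.

Implicit Types (P : dist_family) (theta gamma e a b x y : R * R) (i : 'I_2).

(* For the two-element index set, the only proper nonempty subcollections are
   the singletons {X_i}. *)
Definition marginals_determined P : Prop :=
  forall i theta gamma, coordinate theta i = coordinate gamma i ->
  forall B : set (measurableTypeR R), measurable B ->
  P theta [set x | B (coordinate x i)] = P gamma [set x | B (coordinate x i)].

(* The probability P_t{X_i \in B} that only lists theta_i = t: under
   marginals_determined the value given to the other parameter (here t as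
   well) is irrelevant. *)
Definition marg P i (t : R) (B : set R) : \bar R :=
  P (t, t) [set x | B (coordinate x i)].

Definition diverges_with_parameter P : Prop :=
  forall i (c : R),
    (marg P i t `]-oo, c] @[t --> -oo] --> 1%E) /\
    (marg P i t `[c, +oo[ @[t --> +oo] --> 1%E).

Definition has_positive_density P : Prop :=
  forall theta, exists f : plane R -> R,
    [/\ measurable_fun setT f, forall x, 0 < f x
      & forall B, measurable B ->
          P theta B =
          (\int[(@lebesgue_measure R \x @lebesgue_measure R)%E]_(x in B)
             (f x)%:E)%E].

Definition monotone_increasing (M : set (plane R)) : Prop :=
  forall x y, M x -> (forall i, coordinate x i <= coordinate y i) -> M y.

Definition monotone_family P : Prop :=
  forall delta : R * R,
    (forall i, coordinate delta i = -1 \/ coordinate delta i = 1) ->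
  forall M : set (plane R), measurable M -> monotone_increasing M ->
  forall theta gamma,
    (forall i, coordinate delta i * coordinate theta i <=
               coordinate delta i * coordinate gamma i) ->
  let S : set (plane R) := [set x | M (delta.1 * x.1, delta.2 * x.2)] in
  (P theta S <= P gamma S)%E.

(* None of the above forces any continuity in theta (replacing theta by a
   discontinuous increasing function of theta preserves it), and since the
   regions A1, A2 below are open, infima over them see the limits
   theta_i -> epsilon_i from the right. *)
Definition right_continuous_at P e : Prop :=
  forall i (c : R),
    marg P i t `[c, +oo[ @[t --> (coordinate e i)^'+] -->
    marg P i (coordinate e i) `[c, +oo[.

(* D x is the set I_x of the indices of the hypotheses rejected at x. *)
Definition rule : Type := plane R -> {set 'I_2}.

Implicit Types D : rule.

(* region D r1 r2 is d_{r1,r2}; reject D i is d_i. *)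
Definition region D (r1 r2 : bool) : set (plane R) :=
  [set x | (i1 \in D x) = r1 /\ (i2 \in D x) = r2].

Definition reject D i : set (plane R) := [set x | i \in D x].

Definition measurable_rule D : Prop :=
  forall r1 r2, measurable (region D r1 r2).

Definition monotone_rule D : Prop :=
  forall x y,
    (forall i, i \in D x -> coordinate x i <= coordinate y i) ->
    (forall i, i \notin D x -> coordinate y i < coordinate x i) ->
  D y = D x.

Definition reject_some_true D theta : set (plane R) :=
  [set x | exists i, coordinate theta i <= 0 /\ i \in D x].

Definition reject_some_false D theta : set (plane R) :=
  [set x | exists i, 0 < coordinate theta i /\ i \in D x].

Definition FWER_le P (alpha : R) D : Prop :=
  forall theta,
    (P theta (reject_some_true D theta) <= alpha%:E)%E.

Definition in_C P (alpha : R) D : Prop :=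
  [/\ measurable_rule D, monotone_rule D & FWER_le P alpha D].

Definition upper_quadrant b : set (plane R) :=
  [set x | b.1 < x.1 /\ b.2 < x.2].

Definition in_C_upper P (alpha : R) b D : Prop :=
  in_C P alpha D /\ region D true true = upper_quadrant b.

Definition A1 e : set (R * R) :=
  [set theta | e.1 < theta.1] `|` [set theta | e.2 < theta.2].

Definition A2 e : set (R * R) :=
  [set theta | e.1 < theta.1] `&` [set theta | e.2 < theta.2].

Definition crit_both P e D : \bar R :=
  ereal_inf [set P theta (region D true true) | theta in A2 e].

Definition crit_any P e D : \bar R :=
  ereal_inf [set P theta (~` region D false false) | theta in A1 e].

Definition crit_any_false P e D : \bar R :=
  ereal_inf [set P theta (reject_some_false D theta) | theta in A1 e].

Definition maximizes (cls : rule -> Prop) (crit : rule -> \bar R) D : Prop :=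
  cls D /\ forall D', cls D' -> (crit D' <= crit D)%E.

(* Rules can be altered on boundaries of their regions, hence uniqueness up to
   null sets. *)
Definition is_the_maximizer P (cls : rule -> Prop) (crit : rule -> \bar R) D
    : Prop :=
  maximizes cls crit D /\
  forall D', maximizes cls crit D' ->
  forall theta, {ae P theta, forall x, D' x = D x}.

Definition stepup_d00 b a : set (plane R) :=
  [set x | x.1 <= a.1 /\ x.2 <= a.2] `&` ~` upper_quadrant b.

Definition is_stepup b a D : Prop :=
  [/\ region D true true = upper_quadrant b,
      region D false true = [set x | x.1 <= b.1 /\ a.2 < x.2],
      region D true false = [set x | a.1 < x.1 /\ x.2 <= b.2]
    & region D false false = stepup_d00 b a].

Definition calibrated P (alpha : R) e b a : Prop :=
  P (0, 0) (~` stepup_d00 b a) = alpha%:E /\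
  marg P i1 e.1 `[a.1, +oo[ = marg P i2 e.2 `[a.2, +oo[.

End Model.

Arguments dist_family : clear implicits.
Arguments rule : clear implicits.

(* Main.v *)
Require Import Defs.
From mathcomp Require Import all_boot all_order all_algebra.
From mathcomp Require Import all_classical all_reals all_analysis.
From mathcomp Require Import measurable_realfun lra.

(* Write d_i, d_{r1,r2} for the regions of a rule in the class. FWER at
   theta_i = 0 with the other parameter sent to +oo or -oo gives
   d_i <= {X_i >= b_i}, hence d_{1,1} <= {X_1 >= b_1, X_2 >= b_2}: this is (i).
   Sending instead theta_j to -oo and theta_i to e_i bounds inf P(d_{0,0}^c) by
   P_{e_i}{X_i >= s} as soon as X_i >= s wherever only H_i is rejected. So a rule
   doing at least as well as the stepup rule must reject only H_i at points with
   X_i arbitrarily close to a_i or below; by monotonicity its d_{0,0} is then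
   inside that of the stepup rule, and as both have probability at least
   1 - alpha at (0, 0), with equality for the stepup rule, they agree almost
   everywhere. The constants a are found by the intermediate value theorem along
   the curve P_{e_1}{X_1 >= a_1} = P_{e_2}{X_2 >= a_2}. *)

Set Implicit Arguments.
Unset Strict Implicit.
Unset Printing Implicit Defensive.

Import Order.TTheory GRing.Theory Num.Theory.
Import numFieldNormedType.Exports.

Local Open Scope classical_set_scope.
Local Open Scope ring_scope.

(** * Coordinates of the plane and real-valued probabilities *)

Section Measure.
Context {R : realType}.
Implicit Types (P : dist_family R) (theta gamma x y : R * R) (i : 'I_2).
Implicit Types (A B : set (plane R)).

Lemma coordinate_i1 (T : Type) (x : T * T) : coordinate x i1 = x.1.
Proof. by rewrite /coordinate eqxx. Qed.

Lemma coordinate_i2 (T : Type) (x : T * T) : coordinate x i2 = x.2.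
Proof. by []. Qed.

Lemma coordinate_diag (T : Type) (t : T) i : coordinate (t, t) i = t.
Proof. by rewrite /coordinate; case: (i == i1). Qed.

(** Here [rev_ord i] is the index other than [i], so an argument about the two hypotheses can be
    given once, for an arbitrary [i]. *)
Lemma forall_ord2 (Q : 'I_2 -> Prop) i : Q i -> Q (rev_ord i) -> forall j, Q j.
Proof.
move=> Qi Qri j; suff : j = i \/ j = rev_ord i by case=> ->.
by case: i j {Qi Qri} => -[|[|[]]]// ? [[|[|[]]]// ?]; 
  [left|right|right|left]; apply/val_inj.
Qed.

Lemma rev_ord_i1 : rev_ord i1 = i2.
Proof. exact/val_inj. Qed.

Lemma forall_i1i2 (Q : 'I_2 -> Prop) : Q i1 -> Q i2 -> forall j, Q j.
Proof. by move=> Q1 Q2; apply: (@forall_ord2 _ i1); rewrite ?rev_ord_i1. Qed.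

Definition point_at i (s t : R) : R * R := if i == i1 then (s, t) else (t, s).

Lemma coordinate_point_at i s t : coordinate (point_at i s t) i = s.
Proof. by rewrite /coordinate /point_at; case: (i == i1). Qed.

Lemma coordinate_point_at_rev i s t : coordinate (point_at i s t) (rev_ord i) = t.
Proof.
rewrite /coordinate /point_at.
by case: i => -[|[|[]]]//=.
Qed.

Lemma measurable_coordinate i :
  measurable_fun setT (fun x : plane R => coordinate x i : measurableTypeR R).
Proof.
rewrite /coordinate; case: (i == i1); [exact: measurable_fst | exact: measurable_snd].
Qed.

Lemma measurable_preimage_coordinate i (B : set (measurableTypeR R)) :
  measurable B -> measurable [set x : plane R | B (coordinate x i)].
Proof. by move=> mB; rewrite -[X in measurable X]setTI; exact: measurable_coordinate. Qed.

Definition ge_set i (c : R) : set (plane R) := [set x | c <= coordinate x i].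
Definition gt_set i (c : R) : set (plane R) := [set x | c < coordinate x i].

Lemma ge_setE i c : ge_set i c = [set x | `[c, +oo[%classic (coordinate x i)].
Proof. by apply/seteqP; split=> x /=; rewrite in_itv/= andbT. Qed.

Lemma gt_setE i c : gt_set i c = [set x | `]c, +oo[%classic (coordinate x i)].
Proof. by apply/seteqP; split=> x /=; rewrite in_itv/= andbT. Qed.

Lemma measurable_ge_set i c : measurable (ge_set i c).
Proof. by rewrite ge_setE; exact: measurable_preimage_coordinate. Qed.

Lemma measurable_gt_set i c : measurable (gt_set i c).
Proof. by rewrite gt_setE; exact: measurable_preimage_coordinate. Qed.

(** Real values make the inequalities accessible to [lra]; nothing is lost on measurable sets, where
    the measure is finite. *)
Definition pr P theta B : R := fine (P theta B).

Lemma prE P theta B : measurable B -> P theta B = (pr P theta B)%:E.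
Proof. by move=> mB; rewrite /pr fineK// fin_num_measure. Qed.

Lemma pr_lty P theta B : measurable B -> (P theta B < +oo)%E.
Proof. by move=> mB; rewrite prE// ltry. Qed.

Lemma pr_ge0 P theta B : 0 <= pr P theta B.
Proof. exact: fine_ge0. Qed.

Lemma pr_le1 P theta B : measurable B -> pr P theta B <= 1.
Proof. by move=> mB; rewrite -lee_fin -prE// probability_le1. Qed.

Lemma le_pr P theta A B : measurable A -> measurable B ->
  A `<=` B -> pr P theta A <= pr P theta B.
Proof. by move=> mA mB AB; rewrite -lee_fin -!prE// le_measure ?inE. Qed.

Lemma prC P theta A : measurable A -> pr P theta (~` A) = 1 - pr P theta A.
Proof.
move=> mA; apply/EFin_inj; rewrite EFinB -!prE//; last exact: measurableC.
exact: probability_setC.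
Qed.

Lemma prUI P theta A B : measurable A -> measurable B ->
  pr P theta (A `|` B) = pr P theta A + pr P theta B - pr P theta (A `&` B).
Proof.
move=> mA mB; have [mU mI] := (measurableU _ _ mA mB, measurableI _ _ mA mB).
apply/EFin_inj; rewrite EFinB EFinD -!prE//.
by rewrite measureUfinl//; exact: pr_lty.
Qed.

Lemma prU_le P theta A B : measurable A -> measurable B ->
  pr P theta (A `|` B) <= pr P theta A + pr P theta B.
Proof. by move=> mA mB; rewrite prUI// gerBl pr_ge0. Qed.

Lemma prD P theta A B : measurable A -> measurable B ->
  B `<=` A -> pr P theta (A `\` B) = pr P theta A - pr P theta B.
Proof.
move=> mA mB BA; have mD := measurableD mA mB.
apply/EFin_inj; rewrite EFinB -!prE// measureD ?(setIidr BA)//.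
exact: pr_lty.
Qed.

(** Continuity from above of a finite measure, in epsilon form. *)
Lemma pr_nonincreasing_small P theta (F : (set (plane R))^nat) (eps : R) :
  (forall n, measurable (F n)) -> nonincreasing_seq F ->
  P theta (\bigcap_n F n) = 0%E -> 0 < eps -> exists n, pr P theta (F n) < eps.
Proof.
move=> mF Fd F0 eps0.
have : (P theta \o F) @ \oo --> P theta (\bigcap_n F n).
  apply: nonincreasing_cvg_mu => //; last exact: bigcap_measurable.
  exact: pr_lty.
rewrite F0 => /fine_cvgP[_] /cvgrPdist_lt/(_ _ eps0)[n _ /(_ n (leqnn n))] /=.
rewrite sub0r normrN => H; exists n.
by apply: le_lt_trans H; rewrite ler_norm.
Qed.

(** * Null sets, strict monotonicity and continuity of the tails *)

Section Density.
Context (P : dist_family R) (Pdens : has_positive_density P).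

Let mu2 : set (plane R) -> \bar R :=
  (@lebesgue_measure R \x @lebesgue_measure R)%E.

(** A positive density has integral zero only over Lebesgue-null sets. Hence all [P theta] share
    their null sets, which later carries almost sure equality from (0, 0) to every parameter. *)
Lemma pr_eq0_lebesgue theta B : measurable B ->
  P theta B = 0%E <-> mu2 B = 0%E.
Proof.
move=> mB; have [f [mf f0 ->//]] := Pdens theta.
have mfB : measurable_fun B (fun x => (f x)%:E).
  by apply/measurable_EFinP; exact: measurable_funTS.
split=> [intf0|muB0]; last exact: null_set_integral.
have : (\int[(@lebesgue_measure R \x @lebesgue_measure R)%E]_(x in B) `|(f x)%:E| = 0)%E.
  by rewrite -[RHS]intf0; apply: eq_integral => x _; rewrite gee0_abs// lee_fin ltW.
move=> /(ae_eq_integral_abs _ mB mfB) B0.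
apply/negligibleP => //; apply: negligibleS B0 => x Bx /= H.
by move: (H Bx) => -[] /eqP; rewrite gt_eqF.
Qed.

Lemma measure_eq0_indep theta gamma B : measurable B ->
  P theta B = 0%E -> P gamma B = 0%E.
Proof. by move=> mB /pr_eq0_lebesgue-/(_ mB) H; apply/pr_eq0_lebesgue. Qed.

(** Lines being null, weak and strict inequalities give the same probabilities. *)
Lemma measure_line theta i (c : R) : P theta [set x | coordinate x i = c] = 0%E.
Proof.
have mL : measurable [set x : plane R | coordinate x i = c].
  exact: (@measurable_preimage_coordinate _ [set c]).
apply/(pr_eq0_lebesgue _ mL).
rewrite /coordinate; case: (i == i1).
- have -> : [set x : plane R | x.1 = c] = [set c] `*` setT.
    by apply/seteqP; split=> x //= -[].
  rewrite /mu2 product_measure1E//.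
  by rewrite [X in (X * _)%E](lebesgue_measure_set1 c) mul0e.
- have -> : [set x : plane R | x.2 = c] = setT `*` [set c].
    by apply/seteqP; split=> x //= -[].
  rewrite /mu2 product_measure1E//.
  by rewrite [X in (_ * X)%E](lebesgue_measure_set1 c) mule0.
Qed.

Lemma pr_line theta i (c : R) : pr P theta [set x | coordinate x i = c] = 0.
Proof. by rewrite /pr measure_line. Qed.

Lemma pr_pos_box theta A (c d : R * R) : measurable A ->
  c.1 < d.1 -> c.2 < d.2 -> `]c.1, d.1[ `*` `]c.2, d.2[ `<=` A ->
  0 < pr P theta A.
Proof.
move=> mA cd1 cd2 cdA.
have mB : measurable (`]c.1, d.1[ `*` `]c.2, d.2[ : set (plane R)).
  exact: measurableX.
apply: lt_le_trans (le_pr P theta mB mA cdA).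
rewrite lt_neqAle pr_ge0 andbT; apply/eqP => H.
have : P theta (`]c.1, d.1[ `*` `]c.2, d.2[) = 0%E by rewrite prE// -H.
move=> /(pr_eq0_lebesgue _ mB); rewrite /mu2 product_measure1E//.
move=> /eqP; rewrite gt_eqF// mule_gt0//.
  rewrite [ltRHS](lebesgue_measure_itv `]c.1, d.1[)/= lte_fin cd1 -EFinB.
  by rewrite lte_fin subr_gt0.
rewrite [ltRHS](lebesgue_measure_itv `]c.2, d.2[)/= lte_fin cd2 -EFinB.
by rewrite lte_fin subr_gt0.
Qed.

(** Strictness comes from an open rectangle in the difference, which a positive density charges. *)
Lemma pr_lt theta A B (c d : R * R) : measurable A -> measurable B ->
  A `<=` B -> c.1 < d.1 -> c.2 < d.2 ->
  `]c.1, d.1[ `*` `]c.2, d.2[ `<=` B `\` A ->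
  pr P theta A < pr P theta B.
Proof.
move=> mA mB AB c1 c2 cd; rewrite -subr_gt0 -prD//.
by apply: pr_pos_box c1 c2 cd; exact: measurableD.
Qed.

Lemma pr_gt_set theta i c : pr P theta (gt_set i c) = pr P theta (ge_set i c).
Proof.
rewrite /pr; congr fine.
have -> : ge_set i c = gt_set i c `|` [set x | coordinate x i = c].
  apply/seteqP; split=> x; rewrite /ge_set /gt_set/=.
    by rewrite le_eqVlt => /orP[/eqP|]; [right|left].
  by case=> [/ltW|->].
rewrite measureU0//; [exact: measurable_gt_set| |exact: measure_line].
exact: (@measurable_preimage_coordinate _ [set c]).
Qed.

Lemma pr_ge_set_lt theta i c d : c < d ->
  pr P theta (ge_set i d) < pr P theta (ge_set i c).
Proof.
move=> cd; apply: (@pr_lt _ _ _ (point_at i c 0) (point_at i d 1)).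
- exact: measurable_ge_set.
- exact: measurable_ge_set.
- by move=> x; rewrite /ge_set /= => /(lt_le_trans cd)/ltW.
- by rewrite /point_at; case: ifP.
- by rewrite /point_at; case: ifP.
move=> x; rewrite /point_at /ge_set /coordinate /=.
case: ifP => _; rewrite /= !in_itv/= => -[/andP[h1 h2] /andP[h3 h4]].
  by split; [exact: ltW|apply/negP; rewrite -ltNge].
by split; [exact: ltW|apply/negP; rewrite -ltNge].
Qed.

Lemma pr_ge_set_le theta i c d : c <= d ->
  pr P theta (ge_set i d) <= pr P theta (ge_set i c).
Proof.
by rewrite le_eqVlt => /orP[/eqP->//|/(pr_ge_set_lt theta i)/ltW].
Qed.

(** The closed strips around the line x_i = c shrink to that line, which is null. *)
Lemma pr_ge_set_continuous theta i :
  continuous (fun c : R => pr P theta (ge_set i c)).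
Proof.
move=> c; apply/cvgrPdist_lt => eps eps0.
pose F n : set (plane R) :=
  [set x | `[c - n.+1%:R^-1, c + n.+1%:R^-1]%classic (coordinate x i)].
have mF n : measurable (F n) by exact: measurable_preimage_coordinate.
have [||n Fn] := @pr_nonincreasing_small P theta F _ mF _ _ eps0.
- move=> m n mn; apply/subsetPset => x; rewrite /F/= !in_itv/= => /andP[h1 h2].
  have : n.+1%:R^-1 <= m.+1%:R^-1 :> R by rewrite lef_pV2 ?posrE// ler_nat.
  by move=> mn'; rewrite (le_trans _ h1) ?(le_trans h2) ?lerD2l ?lerN2.
- rewrite -[RHS](measure_line theta i c); congr (P theta _).
  apply/seteqP; split=> x/= H; last first.
    by move=> n _; rewrite /F/= in_itv/= H; apply/andP; split;
      [rewrite gerBl|rewrite lerDl]; rewrite invr_ge0.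
  apply/eqP; rewrite eq_le; apply/andP; split; apply/ler_addgt0Pr => e e0.
    have [N _ /(_ N (leqnn N)) NE] := near_infty_natSinv_lt (PosNum e0).
    have := H N I; rewrite /F/= in_itv/= => /andP[_ h]; apply: (le_trans h).
    by rewrite lerD2l; exact: ltW.
  have [N _ /(_ N (leqnn N)) NE] := near_infty_natSinv_lt (PosNum e0).
  have := H N I; rewrite /F/= in_itv/= => /andP[h _].
  by rewrite -lerBlDr; apply: le_trans h; rewrite lerD2l lerN2; exact: ltW.
have n0 : 0 < n.+1%:R^-1 :> R by rewrite invr_gt0.
near=> d.
have : `|c - d| < n.+1%:R^-1 by near: d; exact: cvgr_dist_lt.
rewrite ltr_distlC => /andP[h1 h2].
(* The two tails differ by the probability of s <= x_i < t, a part of the strip [F n]. *)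
have Fd s t : s <= t -> c - n.+1%:R^-1 <= s -> t <= c + n.+1%:R^-1 ->
   pr P theta (ge_set i s) - pr P theta (ge_set i t) < eps.
  move=> st cs tc; rewrite -prD; try exact: measurable_ge_set; last first.
    by move=> x; exact: le_trans.
  apply: le_lt_trans Fn; apply: le_pr => //.
    by apply: measurableD; exact: measurable_ge_set.
  move=> x; rewrite /F /ge_set /= in_itv/= => -[a1 /negP]; rewrite -ltNge => a2.
  by rewrite (le_trans cs a1)/= (le_trans _ tc)// ltW.
have [cd|dc] := leP c d.
  rewrite ger0_norm ?subr_ge0 ?pr_ge_set_le//.
  by apply: Fd => //; [rewrite gerBl ltW|exact: ltW].
rewrite ler0_norm ?subr_le0 ?pr_ge_set_le ?(ltW dc)// opprB.
by apply: Fd => //; [exact: ltW|exact: ltW|rewrite lerDl ltW].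
Unshelve. all: by end_near. Qed.

(** The half-planes x_i >= n decrease to the empty set. *)
Lemma pr_ge_set_small theta i eps : 0 < eps ->
  exists c, pr P theta (ge_set i c) < eps.
Proof.
move=> eps0.
have [||||n Fn] := @pr_nonincreasing_small P theta (fun n => ge_set i n%:R) eps.
- by move=> n; exact: measurable_ge_set.
- move=> m n mn; apply/subsetPset => x; rewrite /ge_set/=; apply: le_trans.
  by rewrite ler_nat.
- rewrite (_ : bigcap _ _ = set0) ?measure0//; apply/seteqP; split=> // x H.
  have := H (Num.bound `|coordinate x i|) I; rewrite /ge_set/= leNgt => /negP; apply.
  exact: le_lt_trans (ler_norm _) (archi_boundP (normr_ge0 _)).
- by [].
by exists n%:R.
Qed.

Lemma pr_ge_set_large theta i eps : 0 < eps ->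
  exists c, 1 - eps < pr P theta (ge_set i c).
Proof.
move=> eps0.
have [||||n Fn] := @pr_nonincreasing_small P theta (fun n => ~` ge_set i (- n%:R)) eps.
- by move=> n; apply: measurableC; exact: measurable_ge_set.
- move=> m n mn; apply/subsetPset; apply: subsetC => x; rewrite /ge_set/=.
  by apply: le_trans; rewrite lerN2 ler_nat.
- rewrite (_ : bigcap _ _ = set0) ?measure0//; apply/seteqP; split=> // x H.
  apply: (H (Num.bound `|coordinate x i|) I); rewrite /ge_set/=.
  rewrite lerNl (le_trans (ler_norm _))// normrN ltW//.
  exact: archi_boundP (normr_ge0 _).
- by [].
exists (- n%:R); rewrite prC in Fn; last exact: measurable_ge_set.
lra.
Qed.

End Density.
End Measure.

(** * Dependence of the tails on theta, and measurability of rejection events *)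

Section Family.
Context {R : realType} (P : dist_family R).
Implicit Types (theta gamma x y e : R * R) (i : 'I_2) (D : rule R).

Lemma upper_quadrantE (b : R * R) :
  upper_quadrant b = gt_set i1 b.1 `&` gt_set i2 b.2.
Proof. by []. Qed.

Lemma measurable_upper_quadrant (b : R * R) : measurable (upper_quadrant b).
Proof.
by rewrite upper_quadrantE; apply: measurableI; exact: measurable_gt_set.
Qed.

Section Marginals.
Context (Pmarg : marginals_determined P).

Lemma margE theta i (c : R) :
  marg P i (coordinate theta i) `[c, +oo[ = (pr P theta (ge_set i c))%:E.
Proof.
rewrite -prE; last exact: measurable_ge_set.
rewrite ge_setE; apply: Pmarg; last exact: measurable_itv.
by rewrite coordinate_diag.
Qed.

Lemma pr_ge_set_eq theta gamma i c : coordinate theta i = coordinate gamma i ->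
  pr P theta (ge_set i c) = pr P gamma (ge_set i c).
Proof. by move=> tg; apply/EFin_inj; rewrite -!margE tg. Qed.

Lemma pr_ge_set_to1 i c (eps : R) : diverges_with_parameter P -> 0 < eps ->
  exists t, forall theta, coordinate theta i = t ->
    1 - eps < pr P theta (ge_set i c).
Proof.
move=> Pdiv eps0; have [_ /fine_cvgP[_ /cvgrPdist_lt/(_ _ eps0) H]] := Pdiv i c.
have [t Ht] := filter_ex H; exists t => theta tE; move: Ht.
rewrite /= -tE margE/=; move: (pr _ _ _) => p; rewrite ltr_distlC => /andP[h _].
by rewrite ltrBlDr; move: h; lra.
Qed.

Lemma pr_ge_set_to0 i c (eps : R) : diverges_with_parameter P -> 0 < eps ->
  exists2 t, t <= 0 & forall theta, coordinate theta i = t ->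
    pr P theta (ge_set i c) < eps.
Proof.
(* The endpoint c - 1 makes the closed half-line of [diverges_with_parameter] disjoint from x_i >=
   c. *)
move=> Pdiv eps0; have [/fine_cvgP[_ /cvgrPdist_lt/(_ _ eps0) H] _] := Pdiv i (c - 1).
have [t [t0 +]] := filter_ex (filterI (nbhs_ninfty_le (num_real 0)) H).
move=> Ht; exists t => // theta tE; move: Ht => /=.
set L : set (plane R) := [set x | `]-oo, c - 1]%classic (coordinate x i)].
have mL : measurable L by exact: measurable_preimage_coordinate.
have -> : marg P i t `]-oo, (c - 1)] = (pr P theta L)%:E.
  rewrite -prE//; apply: Pmarg; last exact: measurable_itv.
  by rewrite tE coordinate_diag.
move=> /=; rewrite ltr_distlC => /andP[h _].
apply: (@le_lt_trans _ _ (pr P theta (~` L))).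
  apply: le_pr; [exact: measurable_ge_set|exact: measurableC|].
  by move=> x; rewrite /ge_set /L/= in_itv/= => cx; apply/negP; rewrite -ltNge; lra.
by rewrite prC//; lra.
Qed.

(** The parameter is taken strictly to the right of e_i because [A1 e] and [A2 e] are open. *)
Lemma pr_ge_set_right e i c (eps : R) : right_continuous_at P e -> 0 < eps ->
  exists2 t, coordinate e i < t & forall theta, coordinate theta i = t ->
    pr P theta (ge_set i c) < pr P e (ge_set i c) + eps.
Proof.
move=> /(_ i c) + eps0; rewrite margE => /fine_cvgP[_ /cvgrPdist_lt/(_ _ eps0) H].
have [t [et +]] := filter_ex (filterI (nbhs_right_gt (coordinate e i)) H).
move=> Ht; exists t => // theta tE; move: Ht => /=.
by rewrite -tE margE/= ltr_distlC => /andP[].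
Qed.

End Marginals.

(** The case delta = (1, 1) of [monotone_family]. *)
Lemma pr_mono (M : set (plane R)) theta gamma : monotone_family P ->
  measurable M -> monotone_increasing M ->
  (forall i, coordinate theta i <= coordinate gamma i) ->
  pr P theta M <= pr P gamma M.
Proof.
move=> Pmono mM Mincr tg; rewrite -lee_fin -!prE//.
have ME : [set x | M ((1 : R, 1 : R).1 * x.1, (1 : R, 1 : R).2 * x.2)] = M.
  by apply/funext => -[x y]; rewrite /= !mul1r.
rewrite -{1 2}ME; apply: (Pmono (1, 1)) => // i; rewrite coordinate_diag; first by right.
by rewrite !mul1r.
Qed.

Lemma ge_set_mono i c : monotone_increasing (@ge_set R i c).
Proof. by move=> x y; rewrite /ge_set/= => cx /(_ i); exact: le_trans. Qed.

Lemma gt_set_mono i c : monotone_increasing (@gt_set R i c).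
Proof. by move=> x y; rewrite /gt_set/= => cx /(_ i); exact: lt_le_trans. Qed.

Lemma measurable_reject D i : measurable_rule D -> measurable (reject D i).
Proof.
move=> mD; move: i; apply: forall_i1i2.
- have -> : reject D i1 = region D true true `|` region D true false.
    apply/seteqP; split=> x; rewrite /reject /region/=.
      by move=> ->; case: (i2 \in D x); [left|right].
    by case=> -[].
  exact: measurableU.
  have -> : reject D i2 = region D true true `|` region D false true.
    apply/seteqP; split=> x; rewrite /reject /region/=.
      by move=> ->; case: (i1 \in D x); [left|right].
    by case=> -[].
  exact: measurableU.
Qed.

Lemma measurable_reject_some D (Q : 'I_2 -> Prop) : measurable_rule D ->
  measurable [set x | exists i, Q i /\ i \in D x].
Proof.
move=> mD; have -> : [set x | exists i, Q i /\ i \in D x] =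
    \bigcup_(i in Q) reject D i.
  by apply/seteqP; split=> x [i]; [case=> ? ?|move=> ? ?]; exists i.
by apply: fin_bigcup_measurable => // i _; exact: measurable_reject.
Qed.

Lemma pr_reject_le alpha D theta i : in_C P alpha D -> coordinate theta i <= 0 ->
  pr P theta (reject D i) <= alpha.
Proof.
move=> [mD _ /(_ theta) FW] ti; rewrite -lee_fin -prE; last exact: measurable_reject.
apply: le_trans FW; apply: le_measure; rewrite ?inE.
- exact: measurable_reject.
- exact: measurable_reject_some.
- by move=> x ix; exists i.
Qed.

(** * Bounds on the rejection regions, and claim (i) *)

Section Bounds.
Context (Pmarg : marginals_determined P).
Context (Pdiv : diverges_with_parameter P).
Context (Pdens : has_positive_density P).
Context (alpha : R) (b : R * R).
Context (bE : forall i, marg P i 0 `[coordinate b i, +oo[ = alpha%:E).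

Lemma pr_ge_set_b theta i : coordinate theta i = 0 ->
  pr P theta (ge_set i (coordinate b i)) = alpha.
Proof. by move=> t0; apply/EFin_inj; rewrite -(bE i) -t0 margE. Qed.

(* By monotonicity D rejects H_i on a quadrant with corner x; letting the other
   parameter tend to +oo or -oo, this quadrant fills {X_i >= x_i}, which must
   then have probability at most alpha under theta_i = 0. *)
Lemma reject_ge D x i : in_C P alpha D -> i \in D x -> coordinate b i <= coordinate x i.
Proof.
move=> CD ix; rewrite leNgt; apply/negP => xb.
set j := rev_ord i.
have H theta (E : set (plane R)) : coordinate theta i = 0 -> measurable E ->
    ge_set i (coordinate x i) `<=` reject D i `|` E ->
    pr P theta (ge_set i (coordinate x i)) <= alpha + pr P theta E.
  move=> t0 mE sub; have [mD _ _] := CD.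
  have mr := measurable_reject i mD.
  apply: le_trans (le_pr P theta (measurable_ge_set _ _) (measurableU _ _ mr mE) sub) _.
  apply: le_trans (prU_le P theta mr mE) _; rewrite lerD2r.
  by apply: pr_reject_le => //; rewrite t0.
pose q := pr P (0, 0) (ge_set i (coordinate x i)).
have z0 : coordinate (0, 0) i = 0 :> R by rewrite coordinate_diag.
(* This excess over the level is the tolerance against which the error from the other coordinate is
   made small. *)
have qa : 0 < q - alpha.
  by rewrite subr_gt0 -(pr_ge_set_b z0); exact: pr_ge_set_lt.
have [mD MD _] := CD.
case: (boolP (j \in D x)) => jx.
- have [t tP] := pr_ge_set_to1 Pmarg j (coordinate x j) Pdiv qa.
  have := tP _ (coordinate_point_at_rev i 0 t).
  have := H (point_at i 0 t) (~` ge_set j (coordinate x j)) (coordinate_point_at _ _ _).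
  rewrite prC; last exact: measurable_ge_set.
  rewrite (pr_ge_set_eq Pmarg (gamma := (0, 0))) ?coordinate_point_at//.
  rewrite -/q -/j => H1 H2.
  suff : q <= alpha + (1 - pr P (point_at i 0 t) (ge_set j (coordinate x j))) by lra.
  apply: H1; first by apply: measurableC; exact: measurable_ge_set.
  move=> y yi; have [xy|xy] := leP (coordinate x j) (coordinate y j); [left|right].
    rewrite /reject/= (MD x y)//.
      by apply: (forall_ord2 (i := i)).
    by apply: (forall_ord2 (i := i)); rewrite -/j ?ix ?jx.
  by apply/negP; rewrite -ltNge.
- have [t t0 tP] := pr_ge_set_to0 Pmarg j (coordinate x j) Pdiv qa.
  have := tP _ (coordinate_point_at_rev i 0 t).
  have := H (point_at i 0 t) (ge_set j (coordinate x j)) (coordinate_point_at _ _ _).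
  rewrite (pr_ge_set_eq Pmarg (gamma := (0, 0))) ?coordinate_point_at//.
  rewrite -/q -/j => H1 H2.
  suff : q <= alpha + pr P (point_at i 0 t) (ge_set j (coordinate x j)) by lra.
  apply: H1; first exact: measurable_ge_set.
  move=> y yi; have [xy|xy] := leP (coordinate x j) (coordinate y j); [right|left] => //.
  rewrite /reject/= (MD x y)//.
    by apply: (forall_ord2 (i := i)); rewrite -/j ?ix ?(negbTE jx).
  by apply: (forall_ord2 (i := i)); rewrite -/j ?ix.
Qed.

(** The closed quadrant exceeds the open one only by points of two lines, which are null. *)
Lemma pr_closed_quadrant theta (A : set (plane R)) : measurable A ->
  (forall x, A x -> forall i, coordinate b i <= coordinate x i) ->
  pr P theta A <= pr P theta (upper_quadrant b).
Proof.
move=> mA Ab.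
pose L i : set (plane R) := [set x | coordinate x i = coordinate b i].
have mL i : measurable (L i).
  exact: (@measurable_preimage_coordinate _ i [set coordinate b i]).
have mQ := measurable_upper_quadrant b.
have sub : A `<=` (upper_quadrant b `|` L i1) `|` L i2.
  move=> x /Ab bx; have := bx i1; have := bx i2.
  rewrite le_eqVlt => /orP[/eqP|h2]; first by right.
  by rewrite le_eqVlt => /orP[/eqP|h1]; left; [right|left].
apply: le_trans (le_pr P theta mA _ sub) _; first by do 2 apply: measurableU => //.
apply: le_trans (prU_le P theta _ (mL i2)) _; first exact: measurableU.
rewrite /L pr_line// addr0 (le_trans (prU_le P theta mQ (mL i1)))//.
by rewrite /L pr_line// addr0.
Qed.

Context (Pmono : monotone_family P).

(* Only the marginals are right-continuous; the intersection of the two events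
   is handled through its union, whose probability increases with theta. *)
Lemma pr_upper_quadrant_right e eps : right_continuous_at P e -> 0 < eps ->
  exists theta, A2 e theta /\
    pr P theta (upper_quadrant b) < pr P e (upper_quadrant b) + eps.
Proof.
move=> RC eps0.
have e2 : 0 < eps / 2 by lra.
have [t1 et1 t1P] := pr_ge_set_right Pmarg i1 b.1 RC e2.
have [t2 et2 t2P] := pr_ge_set_right Pmarg i2 b.2 RC e2.
exists (t1, t2); split => //.
have := t1P (t1, t2) erefl; have := t2P (t1, t2) erefl.
rewrite -!(pr_gt_set Pdens) upper_quadrantE.
have m1 := measurable_gt_set i1 b.1; have m2 := measurable_gt_set i2 b.2.
have := prUI P (t1, t2) m1 m2; have := prUI P e m1 m2.
have : pr P e (gt_set i1 b.1 `|` gt_set i2 b.2) <=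
       pr P (t1, t2) (gt_set i1 b.1 `|` gt_set i2 b.2).
  apply: pr_mono => //; first exact: measurableU.
    by move=> x y [] /gt_set_mono h xy; [left|right]; exact: h.
  by apply: forall_i1i2; exact: ltW.
lra.
Qed.

(** By [reject_ge] for both indices, d_{1,1} of any competitor lies in the closed quadrant. The
    comparison thus holds at each theta, and so for the infima. *)
Lemma crit_both_max D e : in_C P alpha D -> region D true true = upper_quadrant b ->
  maximizes (in_C P alpha) (crit_both P e) D.
Proof.
move=> CD DQ; split=> // D' CD'; apply: le_ereal_inf_tmp => _ [theta te <-].
apply: ge_ereal_inf; exists (P theta (region D' true true)); first by exists theta.
have [mD' _ _] := CD'.
rewrite DQ !prE//; last exact: measurable_upper_quadrant.
rewrite lee_fin; apply: pr_closed_quadrant => // x [x1 x2].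
by apply: forall_i1i2; apply: reject_ge CD' _.
Qed.

(** The quadrant is an increasing set, so its probability over [A2 e] is at least that at e;
    parameters approaching e from the right show that the infimum is no larger. *)
Lemma crit_bothE D e : region D true true = upper_quadrant b ->
  right_continuous_at P e -> crit_both P e D = P e (upper_quadrant b).
Proof.
move=> DQ RC; have mQ := measurable_upper_quadrant b.
apply/eqP; rewrite eq_le; apply/andP; split.
  rewrite prE//; apply/lee_addgt0Pr => eps eps0.
  have [theta [te lt]] := pr_upper_quadrant_right RC eps0.
  apply: ge_ereal_inf; exists (P theta (region D true true)); first by exists theta.
  by rewrite DQ prE// -EFinD lee_fin ltW.
apply: le_ereal_inf_tmp => _ [theta [te1 te2] <-]; rewrite DQ !prE// lee_fin.
apply: pr_mono => //.
  move=> x y [] x1 x2 xy; split; first exact: lt_le_trans (xy i1).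
  exact: lt_le_trans (xy i2).
by apply: forall_i1i2; exact: ltW.
Qed.

End Bounds.
End Family.

(** * Existence and uniqueness of the calibrated constants *)

Section Calibration.
Context {R : realType} (P : dist_family R).
Context (Pdens : has_positive_density P).
Implicit Types (theta gamma x y e a b : R * R) (i j : 'I_2).

Lemma pr_ge_set_ltE theta i c d :
  (pr P theta (ge_set i c) < pr P theta (ge_set i d)) = (d < c).
Proof.
apply/idP/idP; last exact: pr_ge_set_lt.
by apply: contraTT; rewrite -!leNgt; exact: pr_ge_set_le.
Qed.

Lemma pr_ge_set_surj theta i (u : R) : 0 < u < 1 ->
  exists c, pr P theta (ge_set i c) = u.
Proof.
move=> /andP[u0 u1]; have u1' : 0 < 1 - u by lra.
have [d dP] := pr_ge_set_small P theta i u0.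
have [c cP] := pr_ge_set_large P theta i u1'.
have uc : u < pr P theta (ge_set i c) by lra.
have cd : c <= d by rewrite ltW// -(pr_ge_set_ltE theta i) (lt_trans dP).
have [|||w _ <-] := @IVT R (fun c => pr P theta (ge_set i c)) c d u; last by exists w.
- exact: cd.
- by apply: continuous_subspaceT; exact: pr_ge_set_continuous.
- by rewrite ge_min le_max (ltW dP) (ltW uc) orbT.
Qed.

Lemma pr_ge_set_gt0 theta i c : 0 < pr P theta (ge_set i c).
Proof.
apply: le_lt_trans (pr_ge0 P theta (ge_set i (c + 1))) _.
by rewrite pr_ge_set_ltE ltrDl.
Qed.

Lemma pr_ge_set_lt1 theta i c : pr P theta (ge_set i c) < 1.
Proof.
apply: lt_le_trans (pr_le1 P theta (measurable_ge_set i (c - 1))).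
by rewrite pr_ge_set_ltE ltrBlDr ltrDl.
Qed.

(** The points (c, q c) form the curve of equal tails on which the constants are sought. As the tail
    of X_j is strictly decreasing, q d lies within eps of q c once the tail of X_i at d falls
    between those of X_j at q c + eps and q c - eps. *)
Lemma quantile_match theta i j : exists q : R -> R,
  (forall c, pr P theta (ge_set j (q c)) = pr P theta (ge_set i c)) /\ continuous q.
Proof.
have /choice[q qP] : forall c, exists d,
    pr P theta (ge_set j d) = pr P theta (ge_set i c).
  by move=> c; apply: pr_ge_set_surj; rewrite pr_ge_set_gt0 pr_ge_set_lt1.
exists q; split=> // c; apply/cvgrPdist_lt => eps eps0.
have lo : pr P theta (ge_set j (q c + eps)) < pr P theta (ge_set i c).
  by rewrite -qP pr_ge_set_ltE ltrDl.
have hi : pr P theta (ge_set i c) < pr P theta (ge_set j (q c - eps)).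
  by rewrite -qP pr_ge_set_ltE ltrBlDr ltrDl.
have cont := @pr_ge_set_continuous _ _ Pdens theta i c.
near=> d.
have h1 : pr P theta (ge_set i d) < pr P theta (ge_set j (q c - eps)).
  by near: d; exact: (cvgr_lt _ cont).
have h2 : pr P theta (ge_set j (q c + eps)) < pr P theta (ge_set i d).
  by near: d; exact: (cvgr_gt _ cont).
by move: h1 h2; rewrite -!qP !pr_ge_set_ltE ltr_distlC => -> ->.
Unshelve. all: by end_near. Qed.

(** Written as a union of open upper sets, the event is seen to be measurable and increasing, and
    union bounds apply to it. *)
Lemma stepup_d00C b a : ~` stepup_d00 b a =
  gt_set i1 a.1 `|` gt_set i2 a.2 `|` upper_quadrant b.
Proof.
apply/seteqP; split=> x; rewrite /stepup_d00 /gt_set /=; last first.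
  case=> [[h|h] [[h1 h2] _]|h [_ /(_ h)//]]; move: h.
    by rewrite coordinate_i1 ltNge h1.
  by rewrite coordinate_i2 ltNge h2.
move=> h; have [xQ|xQ] := pselect (upper_quadrant b x); [by right|left].
rewrite coordinate_i1 coordinate_i2.
by have [x1|x1] := ltP a.1 x.1; [left|right; rewrite ltNge; apply/negP => x2; apply: h].
Qed.

Lemma measurable_stepup_d00 b a : measurable (stepup_d00 b a).
Proof.
rewrite -[X in measurable X]setCK stepup_d00C; apply: measurableC.
apply: measurableU; last exact: measurable_upper_quadrant.
by apply: measurableU; exact: measurable_gt_set.
Qed.

(** The probability that the stepup rule with constants a rejects something; calibration sets it to
    alpha at (0, 0). *)
Let level theta b a := pr P theta (~` stepup_d00 b a).

Lemma ge_set_le_level theta b a i :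
  pr P theta (ge_set i (coordinate a i)) <= level theta b a.
Proof.
rewrite -pr_gt_set// /level; apply: le_pr; first exact: measurable_gt_set.
  by apply: measurableC; exact: measurable_stepup_d00.
rewrite stepup_d00C; move: i; apply: forall_i1i2 => x h; left; by [left|right].
Qed.

Lemma level_lt theta b a a' : a.1 < a'.1 -> a.2 < a'.2 -> level theta b a' < level theta b a.
Proof.
move=> a1 a2.
(* On this rectangle a_1 < x_1 < a'_1 while x_2 is below both a_2 and b_2: the first coordinate
   causes a rejection with a, and nothing is rejected with a'. *)
apply: (@pr_lt _ _ Pdens _ _ _ (a.1, Num.min a.2 b.2 - 1) (a'.1, Num.min a.2 b.2)).
- by apply: measurableC; exact: measurable_stepup_d00.
- by apply: measurableC; exact: measurable_stepup_d00.
- apply: subsetC => x [[x1 x2] xQ]; split=> //; split.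
    exact: le_trans x1 (ltW a1).
  exact: le_trans x2 (ltW a2).
- by [].
- by rewrite /= ltrBlDr ltrDl.
move=> x [] /=; rewrite !in_itv/= lt_min => /andP[x1 x1'] /andP[_ /andP[x2 x2']].
split.
  by rewrite /stepup_d00/= => -[[]]; rewrite leNgt x1.
move=> h; apply: h; rewrite /stepup_d00/=; split.
  by split; apply/ltW => //; exact: lt_trans a2.
by case=> _; rewrite ltNge (ltW x2').
Qed.

(** The rejection events for a and a' differ only inside the strips between the thresholds. The
    level thus inherits continuity from the marginal tails. *)
Lemma level_dist theta b a a' : `|level theta b a - level theta b a'| <=
  `|pr P theta (ge_set i1 a.1) - pr P theta (ge_set i1 a'.1)| +
  `|pr P theta (ge_set i2 a.2) - pr P theta (ge_set i2 a'.2)|.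
Proof.
have diff i c d : pr P theta (gt_set i c `\` gt_set i d) <=
    `|pr P theta (ge_set i c) - pr P theta (ge_set i d)|.
  have [dc|cd] := leP d c.
    have -> : gt_set i c `\` gt_set i d = set0.
      apply/seteqP; split=> x //.
      by case=> h; apply; apply: le_lt_trans h.
    by rewrite [leLHS]/pr measure0 /= normr_ge0.
  rewrite prD; try exact: measurable_gt_set; last by move=> x; exact: lt_trans.
  by rewrite !pr_gt_set// ler_norm.
wlog suff H : a a' / level theta b a - level theta b a' <=
  `|pr P theta (ge_set i1 a.1) - pr P theta (ge_set i1 a'.1)| +
  `|pr P theta (ge_set i2 a.2) - pr P theta (ge_set i2 a'.2)|.
  rewrite ler_norml H andbT lerNl opprB; apply: le_trans (H _ _) _.
  by rewrite distrC (distrC (pr _ _ (ge_set i2 _))).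
rewrite lerBlDr addrC.
pose d1 := gt_set i1 a.1 `\` gt_set i1 a'.1.
pose d2 := gt_set i2 a.2 `\` gt_set i2 a'.2.
have m1 : measurable d1 by apply: measurableD; exact: measurable_gt_set.
have m2 : measurable d2 by apply: measurableD; exact: measurable_gt_set.
have mC c : measurable (~` stepup_d00 b c).
  by apply: measurableC; exact: measurable_stepup_d00.
have mU := measurableU _ _ (mC a') m1.
apply: (@le_trans _ _ (pr P theta (~` stepup_d00 b a' `|` d1 `|` d2))).
  apply: le_pr => //; first exact: measurableU.
  rewrite !stepup_d00C => x [[h|h]|h]; last by left; left; right.
    by have [h'|h'] := pselect (gt_set i1 a'.1 x); left; [left; left; left|right].
  by have [h'|h'] := pselect (gt_set i2 a'.2 x); [left; left; left; right|right].
apply: le_trans (prU_le P theta mU m2) _; rewrite addrA lerD//; last exact: diff.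
by apply: le_trans (prU_le P theta (mC a') m1) _; rewrite lerD//; exact: diff.
Qed.

Lemma level_le theta b a : level theta b a <=
  pr P theta (ge_set i1 a.1) + pr P theta (ge_set i2 a.2) + pr P theta (upper_quadrant b).
Proof.
rewrite /level stepup_d00C -!(pr_gt_set Pdens).
have [m1 m2] := (measurable_gt_set i1 a.1, measurable_gt_set i2 a.2).
have mU := measurableU _ _ m1 m2.
apply: le_trans (prU_le P theta mU (measurable_upper_quadrant b)) _.
by rewrite lerD2r; exact: prU_le.
Qed.

(** Rejecting on the quadrant alone leaves part of alpha unspent, so large thresholds bring the
    level below alpha. *)
Lemma pr_upper_quadrant_lt theta b :
  pr P theta (upper_quadrant b) < pr P theta (ge_set i1 b.1).
Proof.
apply: (@pr_lt _ _ Pdens _ _ _ (b.1, b.2 - 1) (b.1 + 1, b.2)) => /=.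
- exact: measurable_upper_quadrant.
- exact: measurable_ge_set.
- by move=> x [x1 _]; exact: ltW.
- by rewrite ltrDl.
- by rewrite ltrBlDr ltrDl.
move=> x [] /=; rewrite !in_itv/= => /andP[x1 _] /andP[_ x2].
by split; [exact: ltW|case=> _; rewrite ltNge (ltW x2)].
Qed.

(** On the curve of equal tails the level is continuous. It is at least alpha at c = b_1, where x_1
    > b_1 alone has probability alpha, and at most alpha far out, where both single tails are
    small. *)
Lemma calibrated_exists (alpha : R) theta e b : 
  (forall i, pr P theta (ge_set i (coordinate b i)) = alpha) ->
  exists a, level theta b a = alpha /\
   pr P e (ge_set i1 a.1) = pr P e (ge_set i2 a.2).
Proof.
move=> bE; have [q [qE qcont]] := quantile_match e i1 i2.
pose f c := level theta b (c, q c).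
have fcont : continuous f.
  move=> c; apply/cvgrPdist_lt => eps eps0; have eps2 : 0 < eps / 2 by lra.
  have /cvgrPdist_lt/(_ _ eps2) := @pr_ge_set_continuous _ _ Pdens theta i1 c.
  have cont2 : {for c, continuous ((fun c => pr P theta (ge_set i2 c)) \o q)}.
    by apply: continuous_comp; [exact: qcont|exact: pr_ge_set_continuous].
  move=> c1; have /cvgrPdist_lt/(_ _ eps2) c2 := cont2.
  near=> d; apply: le_lt_trans (level_dist _ _ _ _) _ => /=.
  have : `|pr P theta (ge_set i1 c) - pr P theta (ge_set i1 d)| < eps / 2 by near: d.
  have : `|pr P theta (ge_set i2 (q c)) - pr P theta (ge_set i2 (q d))| < eps / 2.
    by near: d.
  lra.
have Qlt : 0 < alpha - pr P theta (upper_quadrant b).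
  by rewrite subr_gt0 -(bE i1); exact: pr_upper_quadrant_lt.
have eta0 : 0 < (alpha - pr P theta (upper_quadrant b)) / 2 by lra.
have [K1 K1P] := pr_ge_set_small P theta i1 eta0.
have [K2 K2P] := pr_ge_set_small P theta i2 eta0.
(* Since q matches tails under e, this c ensures q M >= K2 for all M >= c. *)
have [c cP] : exists c, pr P e (ge_set i1 c) = pr P e (ge_set i2 K2).
  by apply: pr_ge_set_surj; rewrite pr_ge_set_gt0 pr_ge_set_lt1.
(* Including [b.1] keeps the interval from b_1 to M nonempty. *)
pose M := Num.max K1 (Num.max c b.1).
have fM : f M <= alpha.
  apply: le_trans (level_le _ _ _) _ => /=.
  have : pr P theta (ge_set i1 M) <= pr P theta (ge_set i1 K1).
    by apply: pr_ge_set_le => //; rewrite le_max lexx.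
  have : pr P theta (ge_set i2 (q M)) <= pr P theta (ge_set i2 K2).
    apply: pr_ge_set_le => //; rewrite leNgt -(pr_ge_set_ltE e i2) qE -cP.
    by rewrite pr_ge_set_ltE -leNgt !le_max lexx orbT.
  lra.
have fb : alpha <= f b.1.
  by rewrite -(bE i1); exact: (ge_set_le_level theta b (b.1, q b.1) i1).
have [|||a _ fa] := @IVT R f b.1 M alpha.
- by rewrite !le_max lexx !orbT.
- exact: continuous_subspaceT.
- by rewrite ge_min le_max fb fM orbT.
by exists (a, q a); split; rewrite /= ?qE.
Unshelve. all: by end_near. Qed.

(** Equal tails under e force both thresholds to move in the same direction, and the level is
    strictly decreasing when both increase. *)
Lemma calibrated_unique theta e b a a' : level theta b a = level theta b a' ->
  pr P e (ge_set i1 a.1) = pr P e (ge_set i2 a.2) ->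
  pr P e (ge_set i1 a'.1) = pr P e (ge_set i2 a'.2) -> a = a'.
Proof.
wlog : a a' / a.1 <= a'.1.
  move=> H; have [|/ltW] := leP a.1 a'.1; first exact: H.
  by move=> *; apply/esym; exact: H.
rewrite le_eqVlt => /orP[/eqP a1 _ h h'|a1 + h h'].
  have a2 : a.2 = a'.2.
    by apply/eqP; rewrite eq_le; apply/andP; split;
      rewrite leNgt -(pr_ge_set_ltE e i2) -h -h' a1 ltxx.
  by rewrite [a]surjective_pairing a1 a2 -surjective_pairing.
have a2 : a.2 < a'.2 by rewrite -(pr_ge_set_ltE e i2) -h -h' pr_ge_set_ltE.
by move=> H; have := level_lt theta b a1 a2; rewrite H ltxx.
Qed.

End Calibration.

(** * The stepup rule: its regions, measurability and monotonicity *)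

Section Stepup.
Context {R : realType}.
Implicit Types (theta gamma x y e a b : R * R) (i j : 'I_2) (D : rule R).

Lemma region_none D : region D false false = [set x | forall i, i \notin D x].
Proof.
apply/seteqP; split=> x; rewrite /region /=.
  by case=> h1 h2; apply: forall_i1i2; rewrite ?h1 ?h2.
by move=> h; split; apply/negbTE.
Qed.

Lemma region_both D : region D true true = [set x | forall i, i \in D x].
Proof.
apply/seteqP; split=> x; rewrite /region /=; last by move=> h; split; apply: h.
by case=> h1 h2; apply: forall_i1i2.
Qed.

Lemma measurable_rule_reject D :
  (forall i, measurable (reject D i)) -> measurable_rule D.
Proof.
move=> mD r1 r2.
have m i (r : bool) : measurable [set x | (i \in D x) = r].
  case: r; first exact: mD.
  rewrite (_ : [set x | _] = ~` reject D i); first by apply: measurableC; exact: mD.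
  by apply/seteqP; split=> x; rewrite /reject /=; [move=> ->|move/negP/negbTE].
by apply: (@measurableI _ _ [set x | (i1 \in D x) = r1] [set x | (i2 \in D x) = r2]).
Qed.

(** Each index is decided separately; when b <= a, this produces the four regions of [is_stepup]. *)
Definition stepup b a : rule R := fun x =>
  finset (fun i => (coordinate a i < coordinate x i) || (b.1 < x.1) && (b.2 < x.2)).

Lemma upper_quadrantP b x : upper_quadrant b x <-> ((b.1 < x.1) && (b.2 < x.2)).
Proof. by split=> [[-> ->]|/andP[]]. Qed.

Section Rule.
Context (b a : R * R).
Context (ba : forall i, coordinate b i <= coordinate a i).

Lemma stepup_is_stepup : is_stepup b a (stepup b a).
Proof.
have ba1 := ba i1; have ba2 := ba i2.
rewrite coordinate_i1 in ba1; rewrite coordinate_i2 in ba2.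
by split; apply/seteqP; split=> x;
  rewrite /region /stepup /stepup_d00 /upper_quadrant /= !inE !coordinate_i1
    !coordinate_i2;
  case: (ltP a.1 x.1) => h1; case: (ltP a.2 x.2) => h2;
  case: (ltP b.1 x.1) => h3; case: (ltP b.2 x.2) => h4 /=;
  (try by (case=> *; try (exfalso; lra))); (try by (exfalso; lra)); 
  intuition (try lra).
Qed.

Lemma reject_stepup i : reject (stepup b a) i =
  gt_set i (coordinate a i) `|` upper_quadrant b.
Proof.
apply/seteqP; split=> x; rewrite /reject /stepup /= inE.
  by move=> /orP[|/upper_quadrantP]; [left|right].
by case=> [h|/upper_quadrantP h]; apply/orP; [left|right].
Qed.

Lemma measurable_stepup : measurable_rule (stepup b a).
Proof.
apply: measurable_rule_reject => i; rewrite reject_stepup.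
by apply: measurableU; [exact: measurable_gt_set|exact: measurable_upper_quadrant].
Qed.

Lemma upper_quadrant_coordinate x :
  upper_quadrant b x <-> forall i, coordinate b i < coordinate x i.
Proof.
split=> [[b1 b2]|h]; first exact: forall_i1i2.
by split; [exact: (h i1)|exact: (h i2)].
Qed.

(** The allowed moves preserve membership in the quadrant both ways: a coordinate rejected outside
    it already exceeds a_i >= b_i, and an accepted one only decreases. Outside the quadrant,
    rejection means x_i > a_i, which the moves also preserve. *)
Lemma monotone_stepup : monotone_rule (stepup b a).
Proof.
have inD x i : (i \in stepup b a x) =
    (coordinate a i < coordinate x i) || (b.1 < x.1) && (b.2 < x.2).
  by rewrite inE.
move=> x y xy yx; have [Qx|Qx] := pselect (upper_quadrant b x).
  have allx i : i \in stepup b a x.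
    by rewrite inD; move/upper_quadrantP: Qx => ->; rewrite orbT.
  have Qy : upper_quadrant b y.
    apply/upper_quadrant_coordinate => i; apply: lt_le_trans (xy i (allx i)).
    by move/upper_quadrant_coordinate: Qx.
  apply/setP => i; rewrite allx inD.
  by move/upper_quadrantP: Qy => ->; rewrite orbT.
have Qy : ~ upper_quadrant b y.
  move=> /upper_quadrant_coordinate Qy; apply: Qx; apply/upper_quadrant_coordinate => i.
  have [ix|ix] := boolP (i \in stepup b a x); last exact: lt_trans (Qy i) (yx i ix).
  move: ix; rewrite inD => /orP[|/upper_quadrantP/upper_quadrant_coordinate//].
  exact: le_lt_trans (ba i).
apply/setP => i; have [ix|ix] := boolP (i \in stepup b a x).
  move: (ix); rewrite !inD => /orP[h|/upper_quadrantP//].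
  by rewrite (lt_le_trans h (xy i ix)).
have := yx i ix; move: ix; rewrite !inD negb_or -leNgt => /andP[xa _] yxi.
apply/negbTE; rewrite negb_or -leNgt (le_trans (ltW yxi) xa) /=.
by apply/negP => /upper_quadrantP.
Qed.

End Rule.

(** * Error control and optimality of the calibrated stepup rule *)

Context (P : dist_family R).
Context (Pmarg : marginals_determined P).
Context (Pdiv : diverges_with_parameter P).
Context (Pdens : has_positive_density P).
Context (Pmono : monotone_family P).
Context (alpha : R) (alpha0 : 0 < alpha) (e b a : R * R).
Context (e_gt0 : forall i, 0 < coordinate e i).
Context (bE : forall i, marg P i 0 `[coordinate b i, +oo[ = alpha%:E).
Context (levelE : pr P (0, 0) (~` stepup_d00 b a) = alpha).

(** The tail at a_i is at most the level alpha, which is the tail at b_i, and tails are strictly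
    decreasing. *)
Lemma calibrated_ge i : coordinate b i <= coordinate a i.
Proof.
rewrite leNgt -(pr_ge_set_ltE Pdens (0, 0) i) -leNgt.
rewrite (pr_ge_set_b Pmarg bE) ?coordinate_diag//.
by rewrite -levelE; exact: ge_set_le_level.
Qed.

(** The marginal depends on the i-th parameter alone, so both parameters may be moved to the
    diagonal, where they are ordered in every coordinate. *)
Lemma pr_ge_set_mono theta gamma i c : coordinate theta i <= coordinate gamma i ->
  pr P theta (ge_set i c) <= pr P gamma (ge_set i c).
Proof.
move=> tg.
rewrite (pr_ge_set_eq Pmarg (gamma := (coordinate theta i, coordinate theta i)))
  ?coordinate_diag//.
rewrite [leRHS](pr_ge_set_eq Pmarg (gamma := (coordinate gamma i, coordinate gamma i)))
  ?coordinate_diag//.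
apply: pr_mono => //; [exact: measurable_ge_set|exact: ge_set_mono|].
by move=> j; rewrite !coordinate_diag.
Qed.

(** If some hypothesis is false, at most one H_j is true, and d_j lies in X_j > b_j. If both are
    true, the event of any rejection is increasing, hence most likely at (0, 0), where it has
    probability alpha. *)
Lemma FWER_stepup : FWER_le P alpha (stepup b a).
Proof.
move=> theta; have mD := measurable_stepup b a.
have mT : measurable (reject_some_true (stepup b a) theta).
  exact: measurable_reject_some.
rewrite prE// lee_fin.
have [[i ti]|tP] := pselect (exists i, 0 < coordinate theta i).
  set j := rev_ord i.
  have sub : reject_some_true (stepup b a) theta `<=`
      [set x | coordinate theta j <= 0 /\ reject (stepup b a) j x].
    move=> x [k []]; move: k; apply: (forall_ord2 (i := i)) => //.
    by rewrite leNgt ti.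
  have [tj|tj] := leP (coordinate theta j) 0; last first.
    rewrite (_ : reject_some_true _ _ = set0) ?[pr _ _ _]/pr ?measure0 ?ltW//.
    by apply/seteqP; split=> // x /sub[]; rewrite leNgt tj.
  rewrite -(pr_ge_set_b Pmarg bE (coordinate_diag 0 j)).
  apply: (@le_trans _ _ (pr P theta (ge_set j (coordinate b j)))); last first.
    by apply: pr_ge_set_mono; rewrite coordinate_diag.
  apply: le_pr => //; first exact: measurable_ge_set.
  move=> x /sub[_]; rewrite reject_stepup => -[h|/upper_quadrant_coordinate h];
    apply/ltW => //.
  exact: le_lt_trans (calibrated_ge j) h.
rewrite -levelE; have mC := measurableC (measurable_stepup_d00 b a).
apply: (@le_trans _ _ (pr P theta (~` stepup_d00 b a))).
  apply: le_pr => // x [i [_ ix]].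
  have [_ _ _ <-] := stepup_is_stepup calibrated_ge.
  by rewrite region_none => /(_ i); rewrite ix.
apply: pr_mono => //.
  by move=> x y + xy; rewrite stepup_d00C => -[[]|] h; [left; left|left; right|right];
    [exact: gt_set_mono xy|exact: gt_set_mono xy|];
    move: h => /upper_quadrant_coordinate h; apply/upper_quadrant_coordinate => i;
    exact: lt_le_trans (xy i).
by move=> i; rewrite coordinate_diag leNgt; apply/negP => h; apply: tP; exists i.
Qed.

Lemma stepup_in_C_upper : in_C_upper P alpha b (stepup b a).
Proof.
split; last by have [] := stepup_is_stepup calibrated_ge.
split; [exact: measurable_stepup|exact/monotone_stepup/calibrated_ge|].
exact: FWER_stepup.
Qed.

(* Let theta_i decrease to e_i and the other parameter tend to -oo: the other
   hypothesis is then rejected with vanishing probability. *)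
Lemma crit_any_le D i s : right_continuous_at P e -> in_C P alpha D ->
  (forall x, i \in D x -> rev_ord i \notin D x -> s <= coordinate x i) ->
  (crit_any P e D <= (pr P e (ge_set i s))%:E)%E.
Proof.
move=> RC CD Ds; apply/lee_addgt0Pr => eps eps0; have eps2 : 0 < eps / 2 by lra.
set j := rev_ord i.
have [t et tP] := pr_ge_set_right Pmarg i s RC eps2.
have [t' _ tP'] := pr_ge_set_to0 Pmarg j (coordinate b j) Pdiv eps2.
pose theta := point_at i t t'.
have [mD _ _] := CD.
have m1 := measurable_ge_set i s; have m2 := measurable_ge_set j (coordinate b j).
apply: ge_ereal_inf; exists (P theta (~` region D false false)).
  exists theta => //; rewrite /theta /A1 /point_at; move: et; rewrite /coordinate.
  by case: ifP => _ /=; [left|right].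
have mC := measurableC (mD false false).
rewrite prE// -EFinD lee_fin.
apply: (@le_trans _ _ (pr P theta (ge_set i s `|` ge_set j (coordinate b j)))).
  apply: le_pr => //; first exact: measurableU.
  move=> x; rewrite region_none /= => Dx.
  have [jx|jx] := boolP (j \in D x).
    by right; exact: (reject_ge Pmarg Pdiv Pdens bE CD).
  left; apply: Ds => //; apply: contrapT => /negP ix; apply: Dx.
  exact: (forall_ord2 (i := i)).
apply: le_trans (prU_le P theta m1 m2) _.
have := tP theta (coordinate_point_at _ _ _).
have := tP' theta (coordinate_point_at_rev _ _ _).
lra.
Qed.

(** Upper bounds for the criterion of (ii) thereby serve for that of (iii). *)
Lemma crit_any_false_le D : measurable_rule D ->
  (crit_any_false P e D <= crit_any P e D)%E.
Proof.
move=> mD; apply: le_ereal_inf_tmp => _ [theta te <-].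
apply: ge_ereal_inf; exists (P theta (reject_some_false D theta)); first by exists theta.
apply: le_measure; rewrite ?inE; first exact: measurable_reject_some.
  exact: measurableC.
by move=> x [i [_ ix]]; rewrite region_none => /(_ i); rewrite ix.
Qed.

Context (aE : pr P e (ge_set i1 a.1) = pr P e (ge_set i2 a.2)).
Let u := pr P e (ge_set i1 a.1).

Let uE i : pr P e (ge_set i (coordinate a i)) = u.
Proof. by move: i; apply: forall_i1i2; rewrite ?coordinate_i1 ?coordinate_i2 /u ?aE. Qed.

(** On [A1 e] some theta_i exceeds e_i > 0, so H_i is false, and it is rejected whenever X_i >
    a_i. *)
Lemma crit_any_false_stepup_ge : (u%:E <= crit_any_false P e (stepup b a))%E.
Proof.
apply: le_ereal_inf_tmp => _ [theta te <-].
have [i ei] : exists i, coordinate e i < coordinate theta i.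
  by case: te; [exists i1|exists i2].
have mD := measurable_stepup b a.
rewrite prE; last exact: measurable_reject_some.
rewrite lee_fin -(uE i); apply: (@le_trans _ _ (pr P theta (ge_set i (coordinate a i)))).
  by apply: pr_ge_set_mono; exact: ltW.
rewrite -(pr_gt_set Pdens); apply: le_pr; first exact: measurable_gt_set.
  exact: measurable_reject_some.
move=> x h; exists i; split; first exact: lt_trans ei.
by have : reject (stepup b a) i x by rewrite reject_stepup; left.
Qed.

(** If nothing is rejected at x with x_i > a_i, the criterion forces a y with y_i < x_i where only
    H_i is rejected. Monotonicity then makes x and y agree with a common point, a contradiction. *)
Lemma region_none_sub D : right_continuous_at P e -> in_C_upper P alpha b D ->
  (u%:E <= crit_any P e D)%E -> region D false false `<=` stepup_d00 b a.
Proof.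
move=> RC [CD DQ] uD x; rewrite region_none /= => Dx.
suff xa i : coordinate x i <= coordinate a i.
  split; first by split; [exact: (xa i1)|exact: (xa i2)].
  by rewrite -DQ region_both => /(_ i1); apply/negP.
rewrite leNgt; apply/negP => axi.
(* Otherwise [crit_any_le] with s = x_i would put the criterion strictly below u. *)
have : ~ (forall y, i \in D y -> rev_ord i \notin D y ->
    coordinate x i <= coordinate y i).
  move=> /(crit_any_le RC CD) /(le_trans uD); rewrite lee_fin -(uE i) leNgt.
  by rewrite pr_ge_set_lt.
apply=> y iy jy; rewrite leNgt; apply/negP => yx.
have [_ MD _] := CD.
set j := rev_ord i in jy.
(* D agrees at z both with x, where nothing is rejected, and with y. *)
pose z := point_at i (coordinate y i) (Num.min (coordinate x j) (coordinate y j) - 1).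
have zi : coordinate z i = coordinate y i by exact: coordinate_point_at.
have zj : coordinate z j = Num.min (coordinate x j) (coordinate y j) - 1.
  exact: coordinate_point_at_rev.
have zj' : coordinate z j < coordinate x j /\ coordinate z j < coordinate y j.
  by apply/andP; rewrite -lt_min zj ltrBlDr ltrDl.
have zx : D z = D x.
  apply: MD => k; first by rewrite (negbTE (Dx k)).
  move=> _; move: k; apply: (forall_ord2 (i := i)); first by rewrite zi.
  by case: zj'.
have zy : D z = D y.
  apply: MD; apply: (forall_ord2 (i := i)); rewrite ?zi ?iy//.
    by rewrite -/j (negbTE jy).
  by case: zj'.
by have := Dx i; rewrite -zx zy iy.
Qed.

(** At (0, 0) both hypotheses are true, so error control gives d_{0,0} probability at least 1 -
    alpha, exactly that of the larger set [stepup_d00 b a]. *)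
Lemma region_none_null D theta : right_continuous_at P e -> in_C_upper P alpha b D ->
  (u%:E <= crit_any P e D)%E -> P theta (stepup_d00 b a `\` region D false false) = 0%E.
Proof.
move=> RC CD uD; have sub := region_none_sub RC CD uD.
have [[mD MD FW] _] := CD.
have md := measurable_stepup_d00 b a.
have mdiff := measurableD md (mD false false).
apply: (measure_eq0_indep Pdens (theta := (0, 0))) => //.
rewrite prE//; congr EFin; apply/eqP; rewrite eq_le pr_ge0 andbT prD//.
move: levelE; rewrite prC//.
have := FW (0, 0).
have -> : reject_some_true D (0, 0) = ~` region D false false.
  rewrite region_none; apply/seteqP; split=> x.
    by case=> i [_ ix] /(_ i); rewrite ix.
  move=> /existsNP[i] /negP; rewrite negbK => ix.
  by exists i; rewrite coordinate_diag.
rewrite prE; last exact: measurableC.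
rewrite prC// lee_fin; lra.
Qed.

(** Off a null set the regions d_{0,0} and d_{1,1} of both rules agree. Elsewhere each rejects one
    hypothesis, and the position of x relative to b decides which. *)
Lemma optimal_ae_stepup D theta : right_continuous_at P e -> in_C_upper P alpha b D ->
  (u%:E <= crit_any P e D)%E -> {ae P theta, forall x, D x = stepup b a x}.
Proof.
move=> RC CDu uD; have [CD DQ] := CDu; have [mD _ _] := CD.
pose N := stepup_d00 b a `\` region D false false.
pose L i : set (plane R) := [set x | coordinate x i = coordinate b i].
have mL i : measurable (L i).
  exact: (@measurable_preimage_coordinate _ i [set coordinate b i]).
have mN : measurable N by apply: measurableD => //; exact: measurable_stepup_d00.
have [SQ _ _ S00] := stepup_is_stepup calibrated_ge.
have mNL := measurableU _ _ mN (mL i1).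
exists (N `|` L i1 `|` L i2); split; first exact: measurableU.
  rewrite measureU0//; last exact: measure_line.
  by rewrite measureU0//; [exact: region_none_null|exact: measure_line].
move=> x; apply: contra_notP => xN /=.
have [xd|xd] := pselect (stepup_d00 b a x).
  have xD : region D false false x.
    by apply: contrapT => xD; apply: xN; left; left.
  move: xd; rewrite -S00 region_none => xS; move: xD; rewrite region_none => xD.
  by apply/setP => i; rewrite (negbTE (xD i)) (negbTE (xS i)).
have [xQ|xQ] := pselect (upper_quadrant b x).
  have := xQ; rewrite -{1}DQ region_both => xD.
  move: xQ; rewrite -SQ region_both => xS.
  by apply/setP => i; rewrite (xD i) (xS i).
have xL i : coordinate x i != coordinate b i.
  apply/eqP => xb; apply: xN; move: i xb; apply: forall_i1i2 => xb; last by right.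
  by left; right.
(* Some rejection occurs since x is outside [stepup_d00], and not both since x is outside the
   quadrant. *)
have [i [ix jx]] : exists i, i \in D x /\ rev_ord i \notin D x.
  have [k kx] : exists k, k \in D x.
    apply: contrapT => nx; apply: xd; apply: region_none_sub CDu uD _ _ => //.
    by rewrite region_none => k; apply/negP => kx; apply: nx; exists k.
  have [rx|rx] := boolP (rev_ord k \in D x); last by exists k.
  exfalso; apply: xQ; rewrite -DQ region_both.
  exact: (forall_ord2 (i := k)).
have bx : coordinate b i < coordinate x i.
  by rewrite lt_neqAle eq_sym xL; exact: (reject_ge Pmarg Pdiv Pdens bE CD).
have xb : coordinate x (rev_ord i) <= coordinate b (rev_ord i).
  rewrite leNgt; apply/negP => h; apply: xQ; apply/upper_quadrant_coordinate.
  exact: (forall_ord2 (i := i)).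
have jS : rev_ord i \notin stepup b a x.
  apply/negP => h.
  have : reject (stepup b a) (rev_ord i) x by [].
  rewrite reject_stepup => -[|//]; rewrite /gt_set/= ltNge.
  by rewrite (le_trans xb (calibrated_ge _)).
have iS : i \in stepup b a x.
  apply: contrapT => /negP iS; apply: xd; rewrite -S00 region_none.
  exact: (forall_ord2 (i := i)).
apply/setP; apply: (forall_ord2 (i := i)); first by rewrite ix iS.
by rewrite (negbTE jx) (negbTE jS).
Qed.

Lemma crit_any_optimal D : right_continuous_at P e -> in_C_upper P alpha b D ->
  (u%:E <= crit_any P e D)%E -> crit_any P e D = crit_any P e (stepup b a).
Proof.
move=> RC CD uD; rewrite /crit_any; congr (ereal_inf _); congr image.
apply/funext => theta; have [[mD _ _] _] := CD.
have [_ _ _ ->] := stepup_is_stepup calibrated_ge.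
have md := measurable_stepup_d00 b a.
have sub := region_none_sub RC CD uD.
rewrite !prE; try exact: measurableC.
congr EFin; rewrite !prC//; congr (_ - _).
apply/esym/eqP; rewrite -subr_eq0 -prD//; apply/eqP.
by rewrite /pr region_none_null.
Qed.

(** The stepup rule rejects H_1 alone only where X_1 > a_1, so [crit_any_le] applies with s =
    a_1. *)
Lemma crit_any_stepup : right_continuous_at P e ->
  crit_any P e (stepup b a) = u%:E.
Proof.
move=> RC; have [CS _] := stepup_in_C_upper.
apply/eqP; rewrite eq_le; apply/andP; split; last first.
  apply: le_trans crit_any_false_stepup_ge _.
  exact: crit_any_false_le (measurable_stepup b a).
rewrite -(uE i1); apply: crit_any_le => // x ix.
have : reject (stepup b a) i1 x by [].
rewrite reject_stepup => -[/ltW//|xQ] /negP[].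
have : reject (stepup b a) (rev_ord i1) x by rewrite reject_stepup; right.
by [].
Qed.

(** Stated for any criterion below that of (ii) which still gives the stepup rule at least u, so
    that (ii) and (iii) are both instances. *)
Lemma stepup_is_the_maximizer (crit : rule R -> \bar R) : right_continuous_at P e ->
  (forall D, in_C_upper P alpha b D -> (crit D <= crit_any P e D)%E) ->
  (u%:E <= crit (stepup b a))%E ->
  is_the_maximizer P (in_C_upper P alpha b) crit (stepup b a) /\
  crit (stepup b a) = u%:E.
Proof.
move=> RC critle ucrit; have CS := stepup_in_C_upper.
have uS : crit (stepup b a) = u%:E.
  by apply/eqP; rewrite eq_le ucrit andbT -crit_any_stepup// critle.
split=> //; split.
  split=> // D CD; rewrite uS; apply: le_trans (critle D CD) _.
  have [/ltW//|uD] := ltP (crit_any P e D) u%:E.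
  by rewrite crit_any_optimal// crit_any_stepup.
move=> D [CD Dmax] theta; apply: optimal_ae_stepup => //.
by rewrite -uS; apply: le_trans (Dmax _ CS) (critle _ CD).
Qed.

End Stepup.

(** * Maximin rules for the three criteria *)

Theorem theorem2p2 (R : realType) (P : dist_family R)
    (Pmarg : marginals_determined P)
    (Pdiv : diverges_with_parameter P)
    (Pdens : has_positive_density P)
    (Pmono : monotone_family P)
    (alpha : R) (alpha01 : 0 < alpha < 1)
    (e : R * R) (e_gt0 : forall i, 0 < coordinate e i)
    (b : R * R) (bE : forall i, marg P i 0 `[coordinate b i, +oo[ = alpha%:E) :
  (* (i) *)
  (forall D : rule R, in_C P alpha D ->
     region D true true = upper_quadrant b ->
     (forall i, reject D i `<=` [set x | coordinate b i < coordinate x i]) ->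
     maximizes (in_C P alpha) (crit_both P e) D /\
     (right_continuous_at P e -> crit_both P e D = P e (upper_quadrant b)))
  /\
  exists a : R * R,
    (calibrated P alpha e b a /\
     forall a', calibrated P alpha e b a' -> a' = a) /\
    exists D : rule R,
      [/\ in_C_upper P alpha b D, is_stepup b a D
        & right_continuous_at P e ->
          (* (ii) *)
          (is_the_maximizer P (in_C_upper P alpha b) (crit_any P e) D /\
           (crit_any P e D = marg P i1 e.1 `[a.1, +oo[ /\
            crit_any P e D = marg P i2 e.2 `[a.2, +oo[))
          /\
          (* (iii) *)
          (is_the_maximizer P (in_C_upper P alpha b) (crit_any_false P e) D /\
           (crit_any_false P e D = marg P i1 e.1 `[a.1, +oo[ /\
            crit_any_false P e D = marg P i2 e.2 `[a.2, +oo[))].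
Proof.
have /andP[alpha0 _] := alpha01.
split=> [D CD DQ _|].
  by split; [exact: crit_both_max CD DQ|exact: crit_bothE].
have bP i : pr P (0, 0) (ge_set i (coordinate b i)) = alpha.
  by rewrite (pr_ge_set_b Pmarg bE) ?coordinate_diag.
have m1 c : marg P i1 e.1 `[c, +oo[ = (pr P e (ge_set i1 c))%:E by rewrite -margE.
have m2 c : marg P i2 e.2 `[c, +oo[ = (pr P e (ge_set i2 c))%:E by rewrite -margE.
have mC a := measurableC (measurable_stepup_d00 b a).
have [a [levelE aE]] := calibrated_exists Pdens e bP.
exists a; split.
  split=> [|a' [level' aE']]; first by split; rewrite ?m1 ?m2 ?aE// prE// levelE.
  apply/esym; apply: (calibrated_unique Pdens (theta := (0, 0)) (b := b) (e := e)) => //.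
    by rewrite levelE /pr level'.
  by move: aE'; rewrite m1 m2 => -[].
have maxS := stepup_is_the_maximizer Pmarg Pdiv Pdens Pmono alpha0 e_gt0 bE levelE aE.
exists (stepup b a); split.
- exact: (stepup_in_C_upper Pmarg Pdens Pmono).
- exact/stepup_is_stepup/(calibrated_ge Pmarg Pdens bE levelE).
(* Both marginal expressions now read as the common value, so each pair of equalities asks only for
   the value of the criterion. *)
move=> RC; rewrite m1 m2 -aE; split.
- have [|||maxi ->] := maxS (crit_any P e) => //.
  by rewrite (crit_any_stepup Pmarg Pdiv Pdens Pmono alpha0 e_gt0 bE levelE aE).
- have [|||maxi ->] := maxS (crit_any_false P e) => //.
    by move=> D [[mD _ _] _]; exact: crit_any_false_le.
  exact: (crit_any_false_stepup_ge Pmarg Pdens Pmono b e_gt0 aE).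
Qed.
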